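(* Let $\Gamma$ be a finite connected quiver and $k$ a field. Then the following statements are equivalent: (i) all $k\Gamma$-modules are vertex (positively) graded; (ii) all $P(\Gamma)$-Systems in $P(\Gamma)\text{-}\mathcal{TOP}^{o}$ are vertex (positively) graded. That is: all $k\Gamma$-modules are vertex graded if and only if all $P(\Gamma)$-Systems in $P(\Gamma)\text{-}\mathcal{TOP}^{o}$ are vertex graded; and all $k\Gamma$-modules are vertex positively graded if and only if all $P(\Gamma)$-Systems in $P(\Gamma)\text{-}\mathcal{TOP}^{o}$ are vertex positively graded.
   Context: A quiver $\Gamma=(\Gamma_0,\Gamma_1)$ is an oriented graph with vertex set $\Gamma_0$ and arrow set $\Gamma_1$; it is finite if both sets are finite, and connected if its underlying unoriented graph is connected. $P(\Gamma)$ is the semigroup with zero consisting of $0$ and all paths of $\Gamma$ (including the trivial paths $e_i$, $i\in\Gamma_0$); the product $\rho\rho'$ of paths is their concatenation (first $\rho'$, then $\rho$) if the source of $\rho$ equals the target of $\rho'$, and $0$ otherwise; $0$ is absorbing. The path algebra $k\Gamma$ is the $k$-algebra with basis the paths of $\Gamma$ and this multiplication. Modules are left modules. A $P(\Gamma)$-System is a nonempty topological space $M$ with an action $(\rho,m)\mapsto\rho m$ of $P(\Gamma)$ such that $(\rho\rho')m=\rho(\rho'm)$ and each map $m\mapsto\rho m$ is continuous. It belongs to $P(\Gamma)\text{-}\mathcal{TOP}^{o}$ if: (a) $P(\Gamma)M=M$; (b) there is a unique $\theta_M\in M$ such that $\{\theta_M\}$ is a connected component of $M$ which is an isolated point and $0m=\theta_M$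 for all $m\in M$; (c) if $e_im\neq\theta_M$ then $\alpha m\neq\theta_M$ for every arrow $\alpha$ starting at $i$. $P(\Gamma)_{(i)}$ denotes the set consisting of $0$ and all paths of length $i$ (and $\{0\}$ for $i<0$). A gradation of an object $M$ of $P(\Gamma)\text{-}\mathcal{TOP}^{o}$ is a family of nonempty subsets $\{M_{(i)}\}_{i\in\mathbb Z}$ (homogeneous components) with $M=\bigcup_iM_{(i)}$, $P(\Gamma)_{(i)}M_{(j)}\subseteq M_{(i+j)}$, and $M_{(i)}\cap M_{(j)}=\{\theta_M\}$ for $i\ne j$; a positive gradation is the same with index set $\mathbb Z_{\geq0}$. $M$ is vertex (positively) graded if it has a (positive) gradation such that for every vertex $v$ the set $e_vM$ is contained in some homogeneous component. $(k\Gamma)_{(i)}$ denotes the span of the paths of length $i$. A gradation of a $k\Gamma$-module $M$ is a decomposition $M=\bigoplus_{i\in\mathbb Z}M_{(i)}$ into $k$-subspaces with $(k\Gamma)_{(i)}M_{(j)}\subseteq M_{(i+j)}$; a positive gradation is one indexed by $\mathbb Z_{\ge0}$. $M$ is vertex (positively) graded if it has a (positive) gradation such that for every vertex $v$ the subspace $e_vM$ is contained in some homogeneous component $M_{(i)}$. *)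

(* Defs.v *)
From HB Require Import structures.
From mathcomp Require Import all_boot all_algebra.
From mathcomp Require Import finmap.
From mathcomp Require Import mathcomp_extra boolp classical_sets topology.
From mathcomp.multinomials Require Import monalg.

Set Implicit Arguments.
Unset Strict Implicit.
Unset Printing Implicit Defensive.

Import GRing.Theory.
Local Open Scope classical_set_scope.
Local Open Scope ring_scope.

Record finQuiver := FinQuiver {
  vertex : finType;
  arrow : finType;
  asrc : arrow -> vertex;
  atgt : arrow -> vertex }.

Arguments asrc {f}.
Arguments atgt {f}.

Section Quiver.
Variable G : finQuiver.
Implicit Types (v : vertex G) (s : seq (arrow G)).

(* Adjacency in the underlying unoriented graph. *)
Definition qadj : rel (vertex G) := fun v w =>
  [exists a : arrow G, ((asrc a == v) && (atgt a == w))
                    || ((asrc a == w) && (atgt a == v))].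

Definition qconnected : Prop := forall v w, connect qadj v w.

(* [walk v s]: the arrows of s, listed in the order in which they are
   traversed, can be followed starting at v. *)
Fixpoint walk v s : bool :=
  if s is a :: s' then (asrc a == v) && walk (atgt a) s' else true.

Definition walk_end v s : vertex G := last v [seq atgt a | a <- s].

Lemma walk_cat v s s' :
  walk v (s ++ s') = walk v s && walk (walk_end v s) s'.
Proof. by elim: s v => //= a s IHs v; rewrite IHs andbA. Qed.

Lemma walk_end_cat v s s' :
  walk_end v (s ++ s') = walk_end (walk_end v s) s'.
Proof. by rewrite /walk_end map_cat last_cat. Qed.

Record qpath := QPath {
  qpath_val : vertex G * seq (arrow G);
  qpath_walk : walk qpath_val.1 qpath_val.2 }.

HB.instance Definition _ := [isSub for qpath_val].
HB.instance Definition _ := [Choice of qpath by <:].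

Definition psrc (p : qpath) : vertex G := (val p).1.
Definition parrows (p : qpath) : seq (arrow G) := (val p).2.
Definition ptgt (p : qpath) : vertex G := walk_end (psrc p) (parrows p).
Definition plen (p : qpath) : nat := size (parrows p).

Lemma qpath_eq (p q : qpath) : psrc p = psrc q -> parrows p = parrows q -> p = q.
Proof.
case: p q => [[v s] ws] [[w t] wt]; rewrite /psrc /parrows /= => evw est.
by apply: val_inj; rewrite /= evw est.
Qed.

Definition ptriv v : qpath := @QPath (v, [::]) isT.

Lemma arrow_walk (a : arrow G) : walk (asrc a) [:: a].
Proof. by rewrite /= eqxx. Qed.

Definition parrow (a : arrow G) : qpath := @QPath (asrc a, [:: a]) (arrow_walk a).

Lemma pcat_walk (p q : qpath) :
  psrc p = ptgt q -> walk (psrc q) (parrows q ++ parrows p).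
Proof.
move=> h; rewrite walk_cat -/(ptgt q) -h.
by rewrite (qpath_walk p) (qpath_walk q).
Qed.

(* Right-to-left concatenation: first q, then p. *)
Definition pcat (p q : qpath) (h : psrc p = ptgt q) : qpath :=
  @QPath (psrc q, parrows q ++ parrows p) (pcat_walk h).

(* The semigroup with zero P(Gamma): [None] is 0, [Some p] is the path p. *)
Definition path_sg := option qpath.

Definition pmul (x y : path_sg) : path_sg :=
  match x, y with
  | Some p, Some q => if psrc p =P ptgt q is ReflectT h then Some (pcat h) else None
  | _, _ => None
  end.

Lemma psrc_cat (p q : qpath) (h : psrc p = ptgt q) : psrc (pcat h) = psrc q.
Proof. by []. Qed.

Lemma ptgt_cat (p q : qpath) (h : psrc p = ptgt q) : ptgt (pcat h) = ptgt p.
Proof. by rewrite /ptgt /psrc /= walk_end_cat -/(ptgt q) -h. Qed.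

Lemma pmulA : associative pmul.
Proof.
move=> [p|] [q|] [r|] //=; last by case: eqP.
case: (psrc q =P ptgt r) => [hqr|nqr]; case: (psrc p =P ptgt q) => [hpq|npq] //=.
- case: eqP => [h1|]; last by rewrite ptgt_cat.
  case: eqP => [h2|]; last by rewrite psrc_cat.
  by congr Some; apply: val_inj; rewrite /= /parrows /= catA.
- by case: eqP => // h1; case: npq; rewrite h1 ptgt_cat.
- by case: eqP => // h1; case: nqr; rewrite -h1 psrc_cat.
Qed.

HB.instance Definition _ := Choice.on path_sg.
HB.instance Definition _ := isSemigroup.Build path_sg pmulA.

Lemma pmul0p (x : path_sg) : ((None : path_sg) * x)%g = None. Proof. by []. Qed.
Lemma pmulp0 (x : path_sg) : (x * (None : path_sg))%g = None. Proof. by case: x. Qed.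

Lemma pmul_trivl v (p : qpath) :
  ((Some (ptriv v) : path_sg) * Some p)%g
  = (if v == ptgt p then Some p else None : path_sg).
Proof.
rewrite -[LHS]/(pmul (Some (ptriv v)) (Some p)) /pmul.
have [hv|/eqP nv] := eqVneq v (ptgt p); case: (psrc _ =P ptgt _) => [h|] //.
by congr (Some _); apply: qpath_eq => //; rewrite /parrows /= cats0.
Qed.

Lemma pmul_trivr v (p : qpath) :
  ((Some p : path_sg) * Some (ptriv v))%g
  = (if v == psrc p then Some p else None : path_sg).
Proof.
rewrite -[LHS]/(pmul (Some p) (Some (ptriv v))) /pmul.
have [hv|/eqP nv] := eqVneq v (psrc p); case: (psrc _ =P ptgt _) => [h|h] //.
- by congr (Some _); apply: qpath_eq.
- by case: h; rewrite -hv.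
- by case: nv; rewrite h.
Qed.

(* The elements of P(Gamma) homogeneous of degree i, where the index set I of
   the gradation is int or nat and lengths are embedded in it by n%:R. *)
Definition path_sg_deg (I : nzSemiRingType) (i : I) : set path_sg :=
  [set x : path_sg | if x is Some p then (plen p)%:R = i else True].

End Quiver.

Section PathAlgebra.
Variables (k : fieldType) (G : finQuiver).

Definition path_alg := {malg k[qpath G]}.

HB.instance Definition _ := GRing.Lmodule.on path_alg.

Implicit Types (g : path_alg) (x y : path_sg G) (p q : qpath G).

(* The image of P(Gamma) in the path algebra. *)
Definition pelt x : path_alg := if x is Some p then << p >> else 0.

Definition pa_mul g1 g2 : path_alg :=
  \sum_(p <- msupp g1) \sum_(q <- msupp g2)
    (g1@_p * g2@_q) *: pelt ((Some p : path_sg G) * Some q)%g.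

Definition pa_one : path_alg := \sum_(v : vertex G) pelt (Some (ptriv v)).

Lemma pa_mulEw (d1 d2 : {fset qpath G}) g1 g2 :
  (msupp g1 `<=` d1)%fset -> (msupp g2 `<=` d2)%fset ->
  pa_mul g1 g2 = \sum_(p <- d1) \sum_(q <- d2)
    (g1@_p * g2@_q) *: pelt ((Some p : path_sg G) * Some q)%g.
Proof.
move=> le1 le2; rewrite /pa_mul (big_fset_incl _ le1) /=; last first.
  by move=> p _ /mcoeff_outdom g1p; rewrite big1 // => q _; rewrite g1p mul0r scale0r.
apply: eq_bigr => p _; apply: big_fset_incl => // q _ /mcoeff_outdom ->.
by rewrite mulr0 scale0r.
Qed.

Lemma pa_mulDl : left_distributive pa_mul +%R.
Proof.
move=> g1 g2 g; rewrite (pa_mulEw (msuppD_le g1 g2) (fsubset_refl _)).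
rewrite (pa_mulEw (fsubsetUl _ (msupp g2)) (fsubset_refl _)).
rewrite (pa_mulEw (fsubsetUr (msupp g1) _) (fsubset_refl _)) -big_split /=.
apply: eq_bigr => p _; rewrite -big_split /=; apply: eq_bigr => q _.
by rewrite mcoeffD mulrDl scalerDl.
Qed.

Lemma pa_mulDr : right_distributive pa_mul +%R.
Proof.
move=> g g1 g2; rewrite (pa_mulEw (fsubset_refl _) (msuppD_le g1 g2)).
rewrite (pa_mulEw (fsubset_refl _) (fsubsetUl _ (msupp g2))).
rewrite (pa_mulEw (fsubset_refl _) (fsubsetUr (msupp g1) _)) -big_split /=.
apply: eq_bigr => p _; rewrite -big_split /=; apply: eq_bigr => q _.
by rewrite mcoeffD mulrDr scalerDl.
Qed.

Lemma pa_mul0g : left_zero 0 pa_mul.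
Proof. by move=> g; rewrite /pa_mul msupp0 big_seq_fset0. Qed.

Lemma pa_mulg0 : right_zero 0 pa_mul.
Proof. by move=> g; rewrite /pa_mul big1 // => p _; rewrite msupp0 big_seq_fset0. Qed.

Lemma pa_scaleAl (c : k) g1 g2 : c *: pa_mul g1 g2 = pa_mul (c *: g1) g2.
Proof.
rewrite (pa_mulEw (msuppZ_le c g1) (fsubset_refl _)) /pa_mul scaler_sumr.
apply: eq_bigr => p _; rewrite scaler_sumr; apply: eq_bigr => q _.
by rewrite mcoeffZ scalerA mulrA.
Qed.

Lemma pa_scaleAr (c : k) g1 g2 : c *: pa_mul g1 g2 = pa_mul g1 (c *: g2).
Proof.
rewrite (pa_mulEw (fsubset_refl _) (msuppZ_le c g2)) /pa_mul scaler_sumr.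
apply: eq_bigr => p _; rewrite scaler_sumr; apply: eq_bigr => q _.
by rewrite mcoeffZ scalerA mulrCA.
Qed.

Lemma pa_mul_pelt x y : pa_mul (pelt x) (pelt y) = pelt (x * y)%g.
Proof.
case: x => [p|]; last by rewrite pmul0p /= pa_mul0g.
case: y => [q|]; last by rewrite pmulp0 /= pa_mulg0.
rewrite [LHS](pa_mulEw (d1 := [fset p]%fset) (d2 := [fset q]%fset)) ?msuppU_le //.
by rewrite !big_seq_fset1 !mcoeffUU mulr1 scale1r.
Qed.

Lemma paE g : g = \sum_(p <- msupp g) g@_p *: pelt (Some p).
Proof.
rewrite [LHS]monalgE; apply: eq_bigr => p _; apply/malgP => q.
by rewrite mcoeffZ /pelt !mcoeffU mulrnAr mulr1.
Qed.

Lemma pa_ind (P : path_alg -> Prop) :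
    P 0 -> (forall g1 g2, P g1 -> P g2 -> P (g1 + g2)) ->
    (forall c p, P (c *: pelt (Some p))) ->
  forall g, P g.
Proof. by move=> P0 PD PU g; rewrite [g]paE; elim/big_ind: _. Qed.

Lemma pa_mulA : associative pa_mul.
Proof.
move=> g1 g2 g3; elim/pa_ind: g1 => [|? ? IH1 IH2|c p].
- by rewrite !pa_mul0g.
- by rewrite !pa_mulDl IH1 IH2.
rewrite -!pa_scaleAl; congr (_ *: _); elim/pa_ind: g2 => [|? ? IH1 IH2|d q].
- by rewrite pa_mulg0 !pa_mul0g pa_mulg0.
- by rewrite pa_mulDl !pa_mulDr IH1 IH2 pa_mulDl.
rewrite -pa_scaleAl -!pa_scaleAr -pa_scaleAl; congr (_ *: _).
elim/pa_ind: g3 => [|? ? IH1 IH2|e r].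
- by rewrite !pa_mulg0.
- by rewrite !pa_mulDr IH1 IH2.
by rewrite -!pa_scaleAr !pa_mul_pelt mulgA.
Qed.

Lemma pa_one_pelt p : pa_mul pa_one (pelt (Some p)) = pelt (Some p).
Proof.
have -> : pa_mul pa_one (pelt (Some p)) =
          \sum_v pa_mul (pelt (Some (ptriv v))) (pelt (Some p)).
  rewrite /pa_one; elim/big_rec2: _ => [|v x y _ <-]; first by rewrite pa_mul0g.
  by rewrite pa_mulDl.
rewrite (bigD1 (ptgt p)) //= big1 ?addr0.
  by rewrite (pa_mul_pelt (Some _) (Some p)) pmul_trivl eqxx.
by move=> v /negPf nv; rewrite (pa_mul_pelt (Some _) (Some p)) pmul_trivl nv.
Qed.

Lemma pa_pelt_one p : pa_mul (pelt (Some p)) pa_one = pelt (Some p).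
Proof.
have -> : pa_mul (pelt (Some p)) pa_one =
          \sum_v pa_mul (pelt (Some p)) (pelt (Some (ptriv v))).
  rewrite /pa_one; elim/big_rec2: _ => [|v x y _ <-]; first by rewrite pa_mulg0.
  by rewrite pa_mulDr.
rewrite (bigD1 (psrc p)) //= big1 ?addr0.
  by rewrite (pa_mul_pelt (Some p) (Some _)) pmul_trivr eqxx.
by move=> v /negPf nv; rewrite (pa_mul_pelt (Some p) (Some _)) pmul_trivr nv.
Qed.

Lemma pa_mul1g : left_id pa_one pa_mul.
Proof.
elim/pa_ind => [|g1 g2 IH1 IH2|c p]; first exact: pa_mulg0.
  by rewrite pa_mulDr IH1 IH2.
by rewrite -pa_scaleAr pa_one_pelt.
Qed.

Lemma pa_mulg1 : right_id pa_one pa_mul.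
Proof.
elim/pa_ind => [|g1 g2 IH1 IH2|c p]; first exact: pa_mul0g.
  by rewrite pa_mulDl IH1 IH2.
by rewrite -pa_scaleAl pa_pelt_one.
Qed.

(* A possibly zero ring: the empty quiver gives the zero algebra. *)
HB.instance Definition _ := GRing.Zmodule_isPzRing.Build path_alg
  pa_mulA pa_mul1g pa_mulg1 pa_mulDl pa_mulDr.

(* (k Gamma)_(i), the span of the paths of length i. *)
Definition path_alg_deg (I : nzSemiRingType) (i : I) : set path_alg :=
  [set a | exists (s : seq (qpath G)) (c : qpath G -> k),
     (forall p, p \in s -> (plen p)%:R = i) /\
     a = \sum_(p <- s) c p *: pelt (Some p)].

End PathAlgebra.

Section Systems.
Variable G : finQuiver.

Record psystem := PSystem {
  ps_space :> topologicalType;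
  ps_act : path_sg G -> ps_space -> ps_space;
  ps_nonempty : [set: ps_space] !=set0;
  ps_actM : forall x y m, ps_act (x * y)%g m = ps_act x (ps_act y m);
  ps_act_continuous : forall x, continuous (ps_act x) }.

Definition is_theta (M : psystem) (t : M) : Prop :=
  [/\ connected_component [set: M] t = [set t],
      isolated [set: M] t
    & forall m : M, ps_act None m = t].

(* The objects of P(Gamma)-TOP^o. *)
Record ptopo := PTopo {
  pt_sys :> psystem;
  theta : pt_sys;
  pt_full : [set ps_act x m | x in [set: path_sg G] & m in [set: pt_sys]]
            = [set: pt_sys];
  pt_theta : is_theta theta;
  pt_theta_unique : forall t : pt_sys, is_theta t -> t = theta;
  pt_arrow : forall (a : arrow G) (m : pt_sys),
    ps_act (Some (ptriv (asrc a))) m <> theta ->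
    ps_act (Some (parrow a)) m <> theta }.

Record sys_gradation (I : nzSemiRingType) (M : ptopo) (C : I -> set M) : Prop :=
  SysGradation {
    sg_nonempty : forall i, C i !=set0;
    sg_cover : \bigcup_i C i = [set: M];
    sg_act : forall i j x m,
      path_sg_deg i x -> C j m -> C (i + j) (ps_act x m);
    sg_meet : forall i j, i <> j -> C i `&` C j = [set theta M] }.

Definition sys_vertex_graded_by (I : nzSemiRingType) (M : ptopo) : Prop :=
  exists C : I -> set M, sys_gradation C /\
    forall v : vertex G, exists i, range (@ps_act M (Some (ptriv v))) `<=` C i.

Definition sys_vertex_graded (M : ptopo) := sys_vertex_graded_by int M.
Definition sys_vertex_pos_graded (M : ptopo) := sys_vertex_graded_by nat M.

End Systems.

Section Modules.
Variables (k : fieldType) (G : finQuiver).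

Section Module.
Variable M : lmodType (path_alg k G).

(* The k-vector space structure of a module over the k-algebra k Gamma. *)
Definition kscale (c : k) (m : M) : M := (c *: (1 : path_alg k G)) *: m.

Definition ksubspace (C : set M) : Prop :=
  C 0 /\ forall c m n, C m -> C n -> C (kscale c m + n).

Definition direct_decomposition (I : choiceType) (C : I -> set M) : Prop :=
  (forall m, exists (s : seq I) (f : I -> M),
      (forall i, C i (f i)) /\ m = \sum_(i <- s) f i) /\
  (forall (s : seq I) (f : I -> M), uniq s -> (forall i, C i (f i)) ->
      \sum_(i <- s) f i = 0 -> forall i, i \in s -> f i = 0).

Record mod_gradation (I : nzSemiRingType) (C : I -> set M) : Prop :=
  ModGradation {
    mg_subspace : forall i, ksubspace (C i);
    mg_direct : direct_decomposition C;
    mg_act : forall i j (a : path_alg k G) m,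
      path_alg_deg i a -> C j m -> C (i + j) (a *: m) }.

Definition mod_vertex_graded_by (I : nzSemiRingType) : Prop :=
  exists C : I -> set M, mod_gradation C /\
    forall v : vertex G, exists i,
      range (fun m : M => pelt k (Some (ptriv v)) *: m) `<=` C i.

End Module.

Definition mod_vertex_graded (M : lmodType (path_alg k G)) :=
  mod_vertex_graded_by M int.
Definition mod_vertex_pos_graded (M : lmodType (path_alg k G)) :=
  mod_vertex_graded_by M nat.

End Modules.

(* Main.v *)
Require Import Defs.
From HB Require Import structures.
From mathcomp Require Import all_boot all_algebra.
From mathcomp Require Import mathcomp_extra boolp classical_sets topology.
From mathcomp.multinomials Require Import monalg.

(** Both statements say that the quiver has a potential: a function d from the
    vertices to the index set of the gradations such that
    d (atgt a) = 1 + d (asrc a) for every arrow a.  This is proved for gradations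
    indexed by any semiring I; the theorem is the cases I = int and I = nat.

    Given a potential d, every module and every system is graded by putting in
    degree i the elements m with e_v m = 0 whenever d v <> i
    ([potential_module_graded], [potential_system_graded]).  A path of length l
    raises the potential by l ([potential_path]), so it raises the degree by l,
    and e_v M lies in degree d v.

    Conversely, it is enough to grade one object: k Gamma as a left module over
    itself, respectively P(Gamma) as a discrete system over itself.  If e_v M
    lies in degree d v, then an arrow a : v -> w, regarded as an element of M,
    is both a e_v, of degree 1 + d v, and e_w a, of degree d w; since a <> 0 the
    two degrees agree and d is a potential ([graded_module_potential],
    [graded_system_potential]). *)

Import GRing.Theory.
Local Open Scope classical_set_scope.
Local Open Scope ring_scope.

Definition potential (G : finQuiver) (I : nzSemiRingType) (d : vertex G -> I) :=
  forall a : arrow G, d (atgt a) = 1 + d (asrc a).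

Lemma potential_path (G : finQuiver) (I : nzSemiRingType) (d : vertex G -> I) :
  potential G I d ->
  forall p : qpath G, d (ptgt p) = (plen p)%:R + d (psrc p).
Proof.
move=> dP [[v s] /= ws]; rewrite /ptgt /plen /psrc /parrows /=.
elim: s v ws => [|a s IHs] v /=; first by rewrite add0r.
case/andP=> /eqP <- ws.
rewrite [LHS](IHs _ ws) dP addrA; congr (_ + _).
by rewrite -natr1.
Qed.

(** * Systems *)

Section SystemTheory.
Variables (G : finQuiver) (M : ptopo G).
Implicit Types (m : M) (x : path_sg G) (p : qpath G) (v : vertex G).

Local Notation act := (@ps_act G M).
Local Notation e v := (Some (ptriv v) : path_sg G).

Lemma act_None m : act None m = theta M.
Proof. by case: (pt_theta M). Qed.

Lemma act_theta x : act x (theta M) = theta M.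
Proof. by rewrite -{1}(act_None (theta M)) -ps_actM pmulp0 act_None. Qed.

Lemma act_triv_path v p m :
  act (e v) (act (Some p) m) = if v == ptgt p then act (Some p) m else theta M.
Proof.
by rewrite -ps_actM pmul_trivl; case: ifP => // _; exact: act_None.
Qed.

Lemma act_path_triv p m : act (Some p) (act (e (psrc p)) m) = act (Some p) m.
Proof. by rewrite -ps_actM pmul_trivr eqxx. Qed.

Lemma ptopo_act_ex m : exists x m', act x m' = m.
Proof.
have : [set: M] m by [].
by rewrite -pt_full => -[x _ [m' _ <-]]; exists x, m'.
Qed.

(** The union of the e_v M is all of M, because P(Gamma) M = M. *)
Lemma eq_theta m : (forall v, act (e v) m = theta M) -> m = theta M.
Proof.
have [[p|] [m' <-]] := ptopo_act_ex m; last by rewrite act_None.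
by move=> /(_ (ptgt p)); rewrite act_triv_path eqxx.
Qed.

(** The component of degree i is cut out by equations, rather than taken as the
    union of the e_v M with d v = i, so that the same formula gives a subspace
    in the case of modules. *)
Lemma potential_system_graded (I : nzSemiRingType) (d : vertex G -> I) :
  potential G I d -> sys_vertex_graded_by I M.
Proof.
move=> dP; pose C i := [set m : M | forall v, d v <> i -> act (e v) m = theta M].
have C_theta i : C i (theta M) by move=> v _; exact: act_theta.
have C_path p m : C (d (ptgt p)) (act (Some p) m).
  by move=> v dv; rewrite act_triv_path; case: eqP => // hv; case: dv; rewrite hv.
exists C; split; last by move=> v; exists (d v) => _ [m _ <-]; exact: (C_path (ptriv v)).
split.
- by move=> i; exists (theta M).
- apply/seteqP; split=> // m _; have [[p|] [m' <-]] := ptopo_act_ex m.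
    by exists (d (ptgt p)).
  by exists 0; rewrite // act_None.
- move=> i j [p|] m; last by rewrite act_None.
  move=> /= <- Cm v dv; rewrite act_triv_path; case: eqP => // hv.
  rewrite -act_path_triv Cm ?act_theta // => hj.
  by apply: dv; rewrite hv (potential_path _ _ _ dP) hj.
- move=> i j ij; apply/seteqP; split=> [m [Ci Cj]|_ -> //].
  apply: eq_theta => v; have [dv|/eqP dv] := eqVneq (d v) i; last exact: Ci.
  by apply: Cj; rewrite dv.
Qed.

End SystemTheory.

(** The discrete topology makes every action continuous and isolates 0, which
    serves as the base point theta. *)
Definition regular_psystem (G : finQuiver) : psystem G.
Proof.
refine (@PSystem G (discrete_topology (path_sg G)) (fun x m => (x * m)%g) _ _ _).
- by exists None.
- by move=> x y m; rewrite mulgA.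
- by move=> x m A /=; rewrite !nbhs_principalE => /principal_filterP Am;
     apply/principal_filterP.
Defined.

Lemma regular_theta (G : finQuiver) : @is_theta G (regular_psystem G) None.
Proof.
split=> //; first exact: (zero_dimension_totally_disconnected
  (@discrete_zero_dimension (discrete_topology (path_sg G)))).
split; first by rewrite inE.
exists [set None]; last by rewrite setIT.
exact: (@discrete_set1 (discrete_topology (path_sg G))).
Qed.

Definition regular_ptopo (G : finQuiver) : ptopo G.
Proof.
refine (@PTopo G (regular_psystem G) None _ (regular_theta G) _ _).
- apply/seteqP; split=> // -[p|] _; last by exists None => //; exists None.
  exists (Some p) => //; exists (Some (ptriv (psrc p))) => //.
  by rewrite /= pmul_trivr eqxx.
- by move=> t [_ _ /(_ None)].
- move=> a [p|] //=; rewrite pmul_trivl; case: eqP => // ap _.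
  by rewrite -[(_ * _)%g]/(pmul (Some _) (Some p)) /pmul; case: eqP.
Defined.

(** The arrow a is both a e_v and e_w a for its source v and target w; being
    nonzero, it has only one degree. *)
Lemma graded_system_potential (G : finQuiver) (I : nzSemiRingType) :
  sys_vertex_graded_by I (regular_ptopo G) ->
  exists d : vertex G -> I, potential G I d.
Proof.
case=> C [gC /choice[d Cd]]; exists d => a.
pose A : path_sg G := Some (parrow a).
pose e v : path_sg G := Some (ptriv v).
have Ct : C (d (atgt a)) A.
  by apply: (Cd (atgt a)); exists A; rewrite //= pmul_trivl eqxx.
have Cs : C (d (asrc a)) (e (asrc a)).
  by apply: (Cd (asrc a)); exists (e (asrc a)); rewrite //= pmul_trivl eqxx.
have {}Cs : C (1 + d (asrc a)) A.
  have : C (1 + d (asrc a)) (A * e (asrc a))%g by apply: (sg_act gC) Cs.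
  by rewrite pmul_trivr eqxx.
apply: contrapT => ne.
have : (C (d (atgt a)) `&` C (1 + d (asrc a))) A by [].
by rewrite (sg_meet gC).
Qed.

(** * Modules *)

Section ModuleTheory.
Variables (k : fieldType) (G : finQuiver) (M : lmodType (path_alg k G)).
Implicit Types (m : M) (p : qpath G) (v : vertex G).

Local Notation e v := (pelt k (Some (ptriv v))).

Lemma pelt_mul (x y : path_sg G) : pelt k x * pelt k y = pelt k (x * y)%g.
Proof. exact: pa_mul_pelt. Qed.

Lemma triv_path_scale v p m :
  e v *: (pelt k (Some p) *: m) = if v == ptgt p then pelt k (Some p) *: m else 0.
Proof.
by rewrite scalerA pelt_mul pmul_trivl; case: ifP => // _; rewrite scale0r.
Qed.

Lemma path_triv_scale p m :
  pelt k (Some p) *: (e (psrc p) *: m) = pelt k (Some p) *: m.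
Proof. by rewrite scalerA pelt_mul pmul_trivr eqxx. Qed.

(** The trivial paths decompose the unit of k Gamma. *)
Lemma scale_triv_sum m : m = \sum_v e v *: m.
Proof. by rewrite -scaler_suml -[LHS]scale1r. Qed.

Lemma pa_scale1_mull (c : k) (g : path_alg k G) :
  (c *: (1 : path_alg k G) : path_alg k G) * g = c *: g.
Proof. by rewrite -[LHS]pa_scaleAl; congr (_ *: _); exact: pa_mul1g. Qed.

Lemma pa_scale1_mulr (c : k) (g : path_alg k G) :
  g * (c *: (1 : path_alg k G) : path_alg k G) = c *: g.
Proof. by rewrite -[LHS]pa_scaleAr; congr (_ *: _); exact: pa_mulg1. Qed.

Lemma kscaleE (c : k) (g : path_alg k G) m : (c *: g) *: m = kscale c (g *: m).
Proof. by rewrite /kscale scalerA pa_scale1_mull. Qed.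

(** The scalars c 1 are central in k Gamma, so k Gamma acts k-linearly. *)
Lemma kscaleCA (c : k) (g : path_alg k G) m :
  g *: kscale c m = kscale c (g *: m).
Proof. by rewrite -kscaleE /kscale scalerA pa_scale1_mulr. Qed.

Lemma kscale0 (c : k) : kscale c (0 : M) = 0.
Proof. exact: scaler0. Qed.

Lemma kscaleN1 m : kscale (-1) m = - m.
Proof. by rewrite /kscale scaleN1r scaleNr scale1r. Qed.

Lemma ksubspace_sum (C : set M) (J : Type) (s : seq J) (P : pred J) (F : J -> M) :
  ksubspace C -> (forall j, P j -> C (F j)) -> C (\sum_(j <- s | P j) F j).
Proof.
move=> [C0 CD] CF; elim/big_ind: _ => // x y Cx Cy.
by have := CD 1 x y Cx Cy; rewrite /kscale !scale1r.
Qed.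

Lemma ksubspace_scale (C : set M) (c : k) m : ksubspace C -> C m -> C (kscale c m).
Proof. by move=> [C0 CD] Cm; have := CD c m 0 Cm C0; rewrite addr0. Qed.

(** A common element m of two components would give the relation m + (- m) = 0
    between them. *)
Lemma direct_decomposition_meet (I : choiceType) (C : I -> set M) :
  (forall i, ksubspace (C i)) -> direct_decomposition C ->
  forall i j m, i != j -> C i m -> C j m -> m = 0.
Proof.
move=> CS [_ Cu] i j m ij Ci Cj.
pose f l := if l == i then m else if l == j then - m else 0.
have := Cu [:: i; j] f; rewrite big_cons big_seq1 /f eqxx eq_sym (negPf ij) eqxx subrr.
move=> /(_ _ _ erefl i); rewrite eqxx; apply; rewrite ?mem_head //.
  by rewrite /= inE ij.
move=> l; case: eqP => [-> //|_]; case: eqP => [->|_]; last by case: (CS l).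
by rewrite -kscaleN1; apply: ksubspace_scale.
Qed.

(** The decomposition of m groups the terms of m = \sum_v e_v m by the value of
    d; it is unique because e_v recovers its part of degree d v. *)
Lemma potential_module_graded (I : nzSemiRingType) (d : vertex G -> I) :
  potential G I d -> mod_vertex_graded_by M I.
Proof.
move=> dP; pose C i := [set m : M | forall v, d v <> i -> e v *: m = 0].
have CS i : ksubspace (C i).
  split=> [v _|c m n Cm Cn v dv]; first by rewrite scaler0.
  by rewrite scalerDr kscaleCA Cm // Cn // kscale0 addr0.
have C_path p m : C (d (ptgt p)) (pelt k (Some p) *: m).
  by move=> v dv; rewrite triv_path_scale; case: eqP => // hv; case: dv; rewrite hv.
exists C; split; last by move=> v; exists (d v) => _ [m _ <-]; exact: (C_path (ptriv v)).
split=> //.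
- split=> [m|s f us Cf f0 i si].
    (* distinct vertices may share a degree, which must be summed only once *)
    exists (undup [seq d v | v : vertex G]), (fun i => \sum_(v | d v == i) e v *: m).
    split=> [i|].
      by apply: ksubspace_sum => // v /eqP <-; exact: (C_path (ptriv v)).
    rewrite [LHS]scale_triv_sum.
    under [RHS]eq_bigr do rewrite big_mkcond.
    rewrite [RHS]exchange_big; apply: eq_bigr => v _ /=.
    rewrite (bigD1_seq (d v)) ?undup_uniq ?mem_undup ?map_f ?mem_index_enum //=.
    by rewrite eqxx big1 ?addr0 // => i; rewrite eq_sym => /negPf ->.
  rewrite [LHS]scale_triv_sum big1 // => v _.
  have [dv|/eqP dv] := eqVneq (d v) i; last exact: Cf.
  have := congr1 (fun m => e v *: m) f0; rewrite scaler0 scaler_sumr (bigD1_seq i) //=.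
  rewrite big1 ?addr0 // => j /eqP ji; apply: Cf; rewrite dv; exact: nesym.
- move=> i j _ m [s [c [sl ->]]] Cm.
  rewrite scaler_suml big_seq; apply: ksubspace_sum => // p /sl <- v dv.
  rewrite kscaleE kscaleCA triv_path_scale; case: eqP => [hv|_]; last exact: kscale0.
  rewrite -path_triv_scale Cm ?scaler0 ?kscale0 // => hj.
  by apply: dv; rewrite hv (potential_path _ _ _ dP) hj.
Qed.

End ModuleTheory.

(** The argument for systems carries over, the uniqueness of the degree of the
    nonzero element a now coming from the directness of the decomposition. *)
Lemma graded_module_potential (k : fieldType) (G : finQuiver) (I : nzSemiRingType) :
  mod_vertex_graded_by ((path_alg k G)^o : lmodType (path_alg k G)) I ->
  exists d : vertex G -> I, potential G I d.
Proof.
case=> C [gC /choice[d Cd]]; exists d => a.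
pose A : path_alg k G := pelt k (Some (parrow a)).
pose e v : path_alg k G := pelt k (Some (ptriv v)).
have Ct : C (d (atgt a)) A.
  apply: (Cd (atgt a)); exists A => //.
  by rewrite -[LHS]/(e _ * A) pelt_mul pmul_trivl eqxx.
have Cs : C (d (asrc a)) (e (asrc a)).
  apply: (Cd (asrc a)); exists (e (asrc a)) => //.
  by rewrite -[LHS]/(e _ * e _) pelt_mul pmul_trivl eqxx.
have degA : path_alg_deg (1 : I) A.
  exists [:: parrow a], (fun=> 1); split=> [p|]; first by rewrite inE => /eqP ->.
  by rewrite big_seq1 scale1r.
have {}Cs : C (1 + d (asrc a)) A.
  have := mg_act gC degA Cs; rewrite -[_ *: _]/(A * e _).
  by rewrite pelt_mul pmul_trivr eqxx.
apply: contrapT => /eqP ne.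
have /(congr1 (mcoeff (parrow a))) :=
  direct_decomposition_meet _ _ _ _ _ (mg_subspace gC) (mg_direct gC) _ _ _ ne Ct Cs.
by rewrite mcoeffUU mcoeff0 => /eqP; rewrite oner_eq0.
Qed.

Lemma modules_graded_iff_systems_graded (G : finQuiver) (k : fieldType)
    (I : nzSemiRingType) :
  (forall M : lmodType (path_alg k G), mod_vertex_graded_by M I) <->
  (forall M : ptopo G, sys_vertex_graded_by I M).
Proof.
split=> graded M.
  have [d dP] := graded_module_potential k G I (graded _).
  exact: potential_system_graded dP.
have [d dP] := graded_system_potential G I (graded _).
exact: potential_module_graded dP.
Qed.

Theorem corollary3p10 (G : finQuiver) (k : fieldType) (hG : qconnected G) :
  ((forall M : lmodType (path_alg k G), mod_vertex_graded M) <->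
   (forall M : ptopo G, sys_vertex_graded M)) /\
  ((forall M : lmodType (path_alg k G), mod_vertex_pos_graded M) <->
   (forall M : ptopo G, sys_vertex_pos_graded M)).
Proof. by split; exact: modules_graded_iff_systems_graded. Qed.
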